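(* Let $K,C\subset\mathbb{R}^n$ be closed sets and fix $\bar x\in K\cap C$. Suppose that $$\limsup_{x\to\bar x,\,x'\to\bar x}\bigl(\mathcal{N}_K(x)+\mathcal{N}_C(x')\bigr)\subset\mathcal{N}_K(\bar x)+\mathcal{N}_C(\bar x).$$ Then $$\mathcal{N}_{K\cap C}(\bar x)\subset\mathcal{N}_K(\bar x)+\mathcal{N}_C(\bar x).$$
   Context: Normal cones: for a set $A\subset\mathbb{R}^d$ and $\bar a\in A$, the tangent (Bouligand) cone is $\mathcal{T}_A(\bar a):=\{d\mid \exists t_k\searrow 0,\ d_k\to d\colon \bar a+t_kd_k\in A\ \forall k\}$, the regular normal cone is its polar $\widehat{\mathcal{N}}_A(\bar a):=\{v\mid v^\top d\le 0\ \forall d\in\mathcal{T}_A(\bar a)\}$, and the limiting normal cone is $\mathcal{N}_A(\bar a):=\{v\mid\exists a_k\to\bar a,\ a_k\in A,\ v_k\to v,\ v_k\in\widehat{\mathcal{N}}_A(a_k)\ \forall k\}$. All these sets are empty at points outside $A$, and a sum with an empty set is empty. Outer limit: $\limsup_{x\to\bar x,\,x'\to\bar x}(\mathcal{N}_K(x)+\mathcal{N}_C(x'))$ is the set of all $v\in\mathbb{R}^n$ for which there are sequences $x_k\to\bar x$, $x_k'\to\bar x$, $v_k\to v$ with $v_k\in\mathcal{N}_K(x_k)+\mathcal{N}_C(x_k')$ for all $k\in\mathbb{N}$. *)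

(* Defs.v *)
From HB Require Import structures.
From mathcomp Require Import all_boot all_order all_algebra.
From mathcomp Require Import all_classical all_reals all_analysis.

Set Implicit Arguments.
Unset Strict Implicit.
Unset Printing Implicit Defensive.

Import Order.TTheory GRing.Theory Num.Theory numFieldNormedType.Exports.

Local Open Scope classical_set_scope.
Local Open Scope ring_scope.

(* R^n is 'rV[R]_n. Its library norm is the sup norm, but only the induced
   topology, which is the Euclidean one, is used below. *)
Section Cones.
Context {R : realType} {n : nat}.
Implicit Types (A B : set 'rV[R]_n) (a v d : 'rV[R]_n).

Definition dot v d : R := (v *m d^T) 0 0.

(* In the tangent and normal cones, the conjunct [A a] is the convention that
   they are empty outside A.
   The convergence of t to 0 is from above, not necessarily monotone. *)
Definition tangent_cone A a : set 'rV[R]_n :=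
  [set d | A a /\
    exists (t : nat -> R) (d_ : nat -> 'rV[R]_n),
      [/\ forall k, 0 < t k,
          t k @[k --> \oo] --> 0,
          d_ k @[k --> \oo] --> d
        & forall k, A (a + t k *: d_ k)]].

Definition polar_cone A : set 'rV[R]_n :=
  [set v | forall d, A d -> dot v d <= 0].

Definition regular_normal_cone A a : set 'rV[R]_n :=
  [set v | A a /\ polar_cone (tangent_cone A a) v].

Definition limiting_normal_cone A a : set 'rV[R]_n :=
  [set v | A a /\
    exists a_ v_ : nat -> 'rV[R]_n,
      [/\ a_ k @[k --> \oo] --> a,
          forall k, A (a_ k),
          v_ k @[k --> \oo] --> v
        & forall k, regular_normal_cone A (a_ k) (v_ k)]].

Definition set_sum A B : set 'rV[R]_n := [set u + w | u in A & w in B].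

Definition outer_limit (F : 'rV[R]_n -> 'rV[R]_n -> set 'rV[R]_n)
    (x0 x0' : 'rV[R]_n) : set 'rV[R]_n :=
  [set v | exists x x' v_ : nat -> 'rV[R]_n,
    [/\ x k @[k --> \oo] --> x0,
        x' k @[k --> \oo] --> x0',
        v_ k @[k --> \oo] --> v
      & forall k, F (x k) (x' k) (v_ k)]].

End Cones.

(* Main.v *)
(* No qualification condition is involved: every limiting normal of K `&` C at
   xbar already lies in the outer limit. It suffices to approximate a regular
   normal v of K `&` C at a by sums of regular normals of K and C at points near
   a. For small t > 0, minimise |x - (a + t v)|^2 + k |x - y|^2 over K x C.
   First-order optimality gives k (x - y) in the regular normal cone of C at y
   and a + t v - x - k (x - y) in that of K at x; these sum to
   t v - (x - a). Comparing with the value at (a, a) yields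
   |x - a|^2 <= 2 t v.(x - a), and as k grows the minimisers approach K `&` C,
   where v.(x - a) = o(|x - a|); hence |x - a| = o(t), and the sum divided by t
   is close to v. *)
Require Import Defs.
From HB Require Import structures.
From mathcomp Require Import all_boot all_order all_algebra.
From mathcomp Require Import all_classical all_reals all_analysis.
From mathcomp Require Import ring lra.

Import Order.TTheory GRing.Theory Num.Theory numFieldNormedType.Exports.

Local Open Scope classical_set_scope.
Local Open Scope ring_scope.

(** * The Euclidean inner product and its comparison with the sup norm *)

Section Dot.
Context {R : realType} {n : nat}.
Implicit Types x y z : 'rV[R]_n.

Lemma dotE x y : dot x y = \sum_i x 0 i * y 0 i.
Proof. by rewrite /dot mxE; apply: eq_bigr => i _; rewrite mxE. Qed.

Lemma dotC x y : dot x y = dot y x.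
Proof. by rewrite !dotE; apply: eq_bigr => i _; rewrite mulrC. Qed.

Lemma dotDl x y z : dot (x + y) z = dot x z + dot y z.
Proof. by rewrite /dot mulmxDl mxE. Qed.

Lemma dotNl x y : dot (- x) y = - dot x y.
Proof. by rewrite /dot mulNmx mxE. Qed.

Lemma dotZl c x y : dot (c *: x) y = c * dot x y.
Proof. by rewrite /dot -scalemxAl mxE. Qed.

Lemma dotDr x y z : dot x (y + z) = dot x y + dot x z.
Proof. by rewrite dotC dotDl !(dotC x). Qed.

Lemma dotNr x y : dot x (- y) = - dot x y.
Proof. by rewrite dotC dotNl dotC. Qed.

Lemma dotZr c x y : dot x (c *: y) = c * dot x y.
Proof. by rewrite dotC dotZl dotC. Qed.

Definition dot_linear := (dotDl, dotDr, dotNl, dotNr, dotZl, dotZr).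

Lemma dot_ge0 x : 0 <= dot x x.
Proof. by rewrite dotE; apply: sumr_ge0 => i _; rewrite -expr2 sqr_ge0. Qed.

Lemma coord_le_norm x i : `|x 0 i| <= `|x|.
Proof.
rewrite [leRHS]/Num.norm /= mx_normrE.
exact: (le_bigmax _ (fun ij : 'I_1 * 'I_n => `|x ij.1 ij.2|) (0, i)).
Qed.

(** A coordinatewise substitute for Cauchy-Schwarz; the factor [n] is the price of the sup norm. *)
Lemma dot_le_norm x y : dot x y <= n%:R * (`|x| * `|y|).
Proof.
have -> : n%:R * (`|x| * `|y|) = \sum_(i < n) `|x| * `|y|.
  by rewrite sumr_const card_ord mulr_natl.
rewrite dotE; apply: ler_sum => i _.
by rewrite (le_trans (ler_norm _))// normrM ler_pM ?coord_le_norm.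
Qed.

(** The sup norm, when nonzero, is attained at some coordinate, whose square is one term of the
    sum. *)
Lemma sqr_norm_le_dot x : `|x| ^+ 2 <= dot x x.
Proof.
have [->|x0] := eqVneq `|x| 0; first by rewrite expr0n dot_ge0.
have [[j i] /= xE] := mx_norm_neq0 x0.
rewrite [`|x|]xE (ord1 j) dotE (bigD1 i) //= real_normK ?num_real // -expr2.
by rewrite lerDl sumr_ge0 // => k _; rewrite -expr2 sqr_ge0.
Qed.

Lemma dot_eq0 x : dot x x <= 0 -> x = 0.
Proof.
move=> x0; apply/eqP; rewrite -normr_eq0 -sqrf_eq0.
by rewrite eq_le sqr_ge0 (le_trans (sqr_norm_le_dot x)).
Qed.

Lemma cvg_dot {T : Type} {F : set_system T} {FF : Filter F}
    (f g : T -> 'rV[R]_n) x y :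
  f @ F --> x -> g @ F --> y -> dot (f t) (g t) @[t --> F] --> dot x y.
Proof.
move=> fx gy; rewrite dotE.
under eq_fun do rewrite dotE.
apply: cvg_big => [|i _]; first exact: add_continuous.
apply: cvgM.
  exact: (cvg_comp f (fun M : 'rV_n => M 0 i) fx (@coord_continuous _ _ _ 0 i x)).
exact: (cvg_comp g (fun M : 'rV_n => M 0 i) gy (@coord_continuous _ _ _ 0 i y)).
Qed.

End Dot.

(** * Regular normals: proximal criterion and first-order estimate *)

Section NormalCones.
Context {R : realType} {n : nat}.
Implicit Types (A : set 'rV[R]_n) (a x u v : 'rV[R]_n).

(** With [z - x = t d_k], the right side is quadratic in [t] and the left side linear; dividing by
    [t] and letting [t] tend to 0 leaves [dot u d <= 0]. *)
Lemma proximal_regular_normal A x u c :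
  A x -> (forall z, A z -> dot u (z - x) <= c * dot (z - x) (z - x)) ->
  regular_normal_cone A x u.
Proof.
move=> Ax prox; split=> // d [_ [t [d_ [t_gt0 t0 dd Ad]]]].
have lim0 : t k * (c * dot (d_ k) (d_ k)) @[k --> \oo] --> 0.
  rewrite -(mul0r (c * dot d d)); apply: cvgM => //.
  by apply: cvgM; [exact: cvg_cst|exact: cvg_dot].
have lim1 : dot u (d_ k) @[k --> \oo] --> dot u d.
  by apply: cvg_dot => //; exact: cvg_cst.
apply: (ler_cvg_to lim1 lim0).
near=> k.
have := prox _ (Ad k); rewrite [x + _]addrC addrK !dot_linear.
rewrite (_ : c * _ = t k * (t k * (c * dot (d_ k) (d_ k)))); last by ring.
by rewrite ler_pM2l.
Unshelve. all: by end_near. Qed.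

Lemma regular_sub_limiting A x :
  regular_normal_cone A x `<=` limiting_normal_cone A x.
Proof.
move=> v nv; have [Ax _] := nv; split=> //.
by exists (fun=> x), (fun=> v); split=> //; exact: cvg_cst.
Qed.

(** A cluster point meets every tail in every ball, so [m k] can be picked past [k] within [1/(k+1)]
    of it. Monotonicity of [m] is not claimed: [k <= m k] already makes errors indexed by [m k]
    vanish. *)
Lemma compact_cluster_seq (S : set 'rV[R]_n) (d_ : nat -> 'rV[R]_n) :
  compact S -> (forall k, S (d_ k)) ->
  exists2 d, S d & exists2 m : nat -> nat,
    (forall k, (k <= m k)%N) & d_ (m k) @[k --> \oo] --> d.
Proof.
move=> cS Sd.
have FS : (d_ k @[k --> \oo]) S by exists 0%N => // k _; exact: Sd.
have [d [Sdd dcl]] := cS _ _ FS.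
exists d => //.
have H k : exists m, (k <= m)%N /\ `|d - d_ m| < k.+1%:R^-1.
  have k0 : 0 < k.+1%:R^-1 :> R by rewrite invr_gt0 ltr0n.
  have [||_ [[m km <-]]] :=
      dcl [set d_ m | m in [set m | (k <= m)%N]] (ball d k.+1%:R^-1).
  - by exists k => // m /= km; exists m.
  - exact: nbhsx_ballx.
  by rewrite -ball_normE /= => dm; exists m.
have [m mP] := choice H.
exists m => [k|]; first exact: (mP k).1.
apply/cvgrPdist_lt => e e0.
have /cvgr0Pnorm_lt /(_ e e0) := @cvg_harmonic R.
apply: filterS => k; rewrite ger0_norm ?invr_ge0//; apply: lt_trans.
exact: (mP k).2.
Qed.

(** The little-o form of regular normality. Violators tending to [a] have unit directions that, by
    compactness of the sphere, cluster at a tangent [d]; then [eps <= dot v d <= 0], a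
    contradiction. *)
Lemma regular_normal_eps A a v eps :
  regular_normal_cone A a v -> 0 < eps ->
  exists2 delta, 0 < delta &
    forall x, A x -> `|x - a| < delta -> dot v (x - a) <= eps * `|x - a|.
Proof.
move=> [Aa vpol] eps0; apply: contrapT => nodelta.
have H k : exists x,
    [/\ A x, `|x - a| < k.+1%:R^-1 & eps * `|x - a| < dot v (x - a)].
  apply: contrapT => nox; apply: nodelta; exists k.+1%:R^-1.
    by rewrite invr_gt0.
  move=> x Ax xa; rewrite leNgt; apply/negP => lt; apply: nox.
  by exists x.
have {H nodelta} [x_ xP] := choice H.
have x_gt0 k : 0 < `|x_ k - a|.
  rewrite normr_gt0; apply/eqP => xa0; have [_ _] := xP k.
  by rewrite xa0 normr0 mulr0 /dot trmx0 mulmx0 mxE ltxx.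
pose d_ k := `|x_ k - a|^-1 *: (x_ k - a).
have Sd k : [set d : 'rV[R]_n | `|d| = 1] (d_ k).
  by rewrite /d_ /= normrZ normfV normr_id mulVf// gt_eqF.
have cS : compact [set d : 'rV[R]_n | `|d| = 1].
  apply: bounded_closed_compact.
    by exists 1; split=> // M M1 d /= ->; exact: ltW.
  rewrite (_ : mkset _ = (fun d : 'rV[R]_n => `|d|) @^-1` [set r | r = 1])//.
  by apply: preimage_closed; [move=> d _; exact: norm_continuous|exact: closed_eq].
have [d _ [m km dmd]] := compact_cluster_seq _ _ cS Sd.
suff : eps <= 0 by rewrite leNgt eps0.
apply: (@le_trans _ _ (dot v d)).
  have lim : dot v (d_ (m k)) @[k --> \oo] --> dot v d.
    by apply: cvg_dot => //; exact: cvg_cst.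
  apply: (cvgr_to_ge lim); near=> k.
  have [_ _ lt] := xP (m k).
  by rewrite dotZr ler_pdivlMl// mulrC ltW.
apply: vpol; split=> //; exists (fun k => `|x_ (m k) - a|), (d_ \o m).
split=> // [|k] /=; last first.
  rewrite /d_ scalerA mulfV ?gt_eqF// scale1r addrC subrK.
  by have [] := xP (m k).
apply: (squeeze_cvgr _ (cvg_cst 0) (@cvg_harmonic R)); near=> k.
rewrite normr_ge0 /=; have [_ /ltW xm _] := xP (m k).
by rewrite (le_trans xm)// lef_pV2 ?posrE// ler_nat ltnS.
Unshelve. all: by end_near. Qed.

End NormalCones.

(** * Penalised minimisation and the fuzzy intersection rule *)

Section FuzzyIntersection.
Context {R : realType} {n : nat}.
Implicit Types (K C : set 'rV[R]_n) (a b v x y : 'rV[R]_n).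

Lemma closed_le_fun {T : topologicalType} (f g : T -> R) :
  continuous f -> continuous g -> closed [set p | f p <= g p].
Proof.
move=> cf cg.
rewrite (_ : mkset _ = (fun p => f p - g p) @^-1` [set r | r <= 0]).
  by apply: preimage_closed; [move=> p _; apply: cvgB; [exact: cf|exact: cg]
                             |exact: closed_le].
by apply/seteqP; split=> p /=; rewrite subr_le0.
Qed.

Lemma bounded_closed_compact_pair (S : set ('rV[R]_n * 'rV[R]_n)) (M : R) :
  closed S -> (forall p, S p -> `|p.1| <= M /\ `|p.2| <= M) -> compact S.
Proof.
move=> cS SM; pose B := [set x : 'rV[R]_n | `|x| <= M].
have cB : compact B.
  apply: bounded_closed_compact.
    by exists M; split=> [|N MN x /= xM]; rewrite ?num_real// (le_trans xM)// ltW.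
  by apply: closed_le_fun; [exact: norm_continuous|exact: cst_continuous].
by apply: (subclosed_compact cS (compact_setX cB cB)) => p /SM [].
Qed.

Lemma continuous_dist_sqr a :
  continuous (fun p : 'rV[R]_n * 'rV[R]_n => dot (p.1 - a) (p.1 - a)).
Proof.
by move=> p; apply: cvg_dot; apply: cvgB; try exact: cvg_fst; exact: cvg_cst.
Qed.

Lemma continuous_gap_sqr :
  continuous (fun p : 'rV[R]_n * 'rV[R]_n => dot (p.1 - p.2) (p.1 - p.2)).
Proof.
by move=> p; apply: cvg_dot; apply: cvgB; try exact: cvg_fst; exact: cvg_snd.
Qed.

Lemma closed_setX K C : closed K -> closed C -> closed (K `*` C).
Proof.
move=> cK cC; rewrite (_ : _ `*` _ = fst @^-1` K `&` snd @^-1` C)//.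
apply: closedI; apply: preimage_closed => // p _; [exact: cvg_fst|exact: cvg_snd].
Qed.

Definition penalty k b x y : R := dot (x - b) (x - b) + k * dot (x - y) (x - y).

(** A crude bound avoiding square roots; it serves only to show that sets are bounded. *)
Lemma norm_le_sqr x (T : R) : dot x x <= T -> `|x| <= T + 1.
Proof.
by move=> /(le_trans (sqr_norm_le_dot x)) xT; have := sqr_ge0 (`|x| - 1); nra.
Qed.

Lemma penalty_minimizer K C a b k :
  closed K -> closed C -> K a -> C a -> 1 <= k ->
  exists2 p : 'rV[R]_n * 'rV[R]_n, (K `*` C) p &
    forall x y, K x -> C y -> penalty k b p.1 p.2 <= penalty k b x y.
Proof.
move=> cK cC Ka Ca k1.
have cpen : continuous (fun p : 'rV[R]_n * 'rV[R]_n => penalty k b p.1 p.2).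
  move=> p; apply: cvgD; first exact: continuous_dist_sqr.
  by apply: cvgM; [exact: cvg_cst|exact: continuous_gap_sqr].
pose T := penalty k b a a.
(* [K] and [C] may be unbounded, so the minimum is sought on the sublevel set of the value at
   [(a, a)]. As [1 <= k], both squared distances there are at most [T]. *)
pose S := (K `*` C) `&` [set p | penalty k b p.1 p.2 <= T].
have cS : compact S.
  apply: (@bounded_closed_compact_pair _ (`|b| + (T + 1) *+ 2)).
    apply: closedI; first exact: closed_setX.
    by apply: closed_le_fun => //; exact: cst_continuous.
  move=> [x y] [_]; rewrite /penalty /= => xyT.
  have xb := dot_ge0 (x - b); have xy := dot_ge0 (x - y).
  have /norm_le_sqr nxb : dot (x - b) (x - b) <= T by nra.
  have /norm_le_sqr nxy : dot (x - y) (x - y) <= T by nra.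
  have := ler_normD (x - b) b; rewrite subrK => nx.
  have := ler_normB x (x - y); rewrite opprB addrC subrK => ny.
  by have := normr_ge0 (x - b); split; lra.
have S0 : S !=set0 by exists (a, a); split=> //=; exact: lexx.
have [p pS pmin] := compact_EVT_min S0 cS (continuous_subspaceT cpen).
move: pS; rewrite inE => -[KCp pT]; exists p => // x y Kx Cy.
have [xyT|/ltW xyT] := leP (penalty k b x y) T; last exact: le_trans xyT.
by apply: (pmin (x, y)); rewrite inE.
Qed.

(** Freezing one variable, the penalty is quadratic in the other, with leading coefficient [1 + k]
    in [x] and [k] in [y]. Minimality is thus a proximal inequality with half that coefficient,
    scaled by [t]. *)
Lemma penalty_normals K C b k t p :
  (K `*` C) p -> 0 <= t ->
  (forall x y, K x -> C y -> penalty k b p.1 p.2 <= penalty k b x y) ->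
  regular_normal_cone K p.1 (t *: (b - p.1 - k *: (p.1 - p.2))) /\
  regular_normal_cone C p.2 (t *: (k *: (p.1 - p.2))).
Proof.
case: p => x y /= [Kx Cy] t0 pmin; split.
  apply: (@proximal_regular_normal _ _ _ _ _ (t * (1 + k) / 2)) => // z Kz.
  have := pmin z y Kz Cy; rewrite /penalty !dot_linear.
  rewrite (dotC b x) (dotC y x) (dotC z x) (dotC z b) (dotC z y).
  nra.
apply: (@proximal_regular_normal _ _ _ _ _ (t * k / 2)) => // z Cz.
have := pmin x z Kx Cz; rewrite /penalty !dot_linear.
rewrite (dotC y x) (dotC z x) (dotC z y).
nra.
Qed.

Lemma penalty_minimizer_near K C a v t eta :
  closed K -> closed C -> (K `&` C) a -> 0 < t -> 0 < eta ->
  (forall x, (K `&` C) x -> `|x - a| <= 2 * t * n%:R * `|v| ->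
     dot v (x - a) <= eta / 4 * `|x - a|) ->
  exists k p,
    [/\ (K `*` C) p,
        forall x y, K x -> C y ->
          penalty k (a + t *: v) p.1 p.2 <= penalty k (a + t *: v) x y,
        `|p.1 - a| < t * eta
      & dot (p.1 - p.2) (p.1 - p.2) <= t ^+ 2 * dot v v].
Proof.
move=> cK cC [Ka Ca] t0 eta0 small.
set V := t ^+ 2 * dot v v.
have V0 : 0 <= V by rewrite mulr_ge0 ?sqr_ge0 ?dot_ge0.
have le_norm x : dot (x - a) (x - a) <= 2 * t * dot v (x - a) ->
    `|x - a| <= 2 * t * n%:R * `|v|.
  move=> xa; have := dot_le_norm v (x - a); have := sqr_norm_le_dot (x - a).
  have := normr_ge0 (x - a); rewrite le_eqVlt => /predU1P[<- _ _|xa0 h1 h2].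
    by rewrite !mulr_ge0// ltW.
  rewrite -(ler_pM2r xa0) -expr2 (le_trans h1)// (le_trans xa)//.
  by rewrite -!mulrA !ler_pM2l.
(* [S] gathers the pairs far from [a] that obey the two estimates valid for every minimiser; a
   suitable [k] must exclude them. *)
pose S := (K `*` C) `&` ([set p | t * eta <= `|p.1 - a|] `&`
  [set p | dot (p.1 - a) (p.1 - a) <= 2 * t * dot v (p.1 - a)] `&`
  [set p | dot (p.1 - p.2) (p.1 - p.2) <= V]).
have cS : compact S.
  apply: (@bounded_closed_compact_pair _
    (`|a| + 2 * t * n%:R * `|v| + (V + 1))).
    apply: closedI; first exact: closed_setX.
    apply: closedI; first apply: closedI.
    - apply: closed_le_fun; first exact: cst_continuous.
      move=> p; apply: cvg_norm; apply: cvgB; first exact: cvg_fst.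
      exact: cvg_cst.
    - apply: closed_le_fun; first exact: continuous_dist_sqr.
      move=> p; apply: cvgM; first exact: cvg_cst.
      apply: cvg_dot; first exact: cvg_cst.
      by apply: cvgB; [exact: cvg_fst|exact: cvg_cst].
    - by apply: closed_le_fun; [exact: continuous_gap_sqr|exact: cst_continuous].
  move=> [x y] [_ [[_ /= /le_norm xa] /norm_le_sqr nxy]].
  have := ler_normD (x - a) a; rewrite subrK => nx.
  have := ler_normB x (x - y); rewrite opprB addrC subrK => ny.
  by have := normr_ge0 (x - y); split; lra.
have [m m0 mS] : exists2 m, 0 < m &
    forall p, S p -> m <= dot (p.1 - p.2) (p.1 - p.2).
  have [->|/set0P S0] := eqVneq S set0; first by exists 1.
  have [[x y] + qmin] :=
    compact_EVT_min S0 cS (continuous_subspaceT continuous_gap_sqr).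
  rewrite inE => -[[/= Kx Cy] [[/= xa xav] xyV]].
  exists (dot (x - y) (x - y)); last by move=> p Sp; apply: qmin; rewrite inE.
  (* If the gap vanished, [x] would lie in both sets, and [small] would give
     [|x - a|^2 <= 2 t (eta/4) |x - a|], so [|x - a| <= t eta / 2], against [t eta <= |x - a|]. *)
  rewrite ltNge; apply/negP => /dot_eq0 /subr0_eq xy.
  rewrite -xy in Cy.
  have := small x (conj Kx Cy) (le_norm _ xav).
  have := sqr_norm_le_dot (x - a).
  have := mulr_gt0 t0 eta0; nra.
(* On [S] the penalty k |x - y|^2 exceeds [V], so minimisers avoid [S]. *)
pose k := 1 + V / m.
have k1 : 1 <= k by rewrite lerDl divr_ge0// ltW.
have [p KCp pmin] := penalty_minimizer _ _ _ (a + t *: v) _ cK cC Ka Ca k1.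
have pV : penalty k (a + t *: v) p.1 p.2 <= V.
  apply: le_trans (pmin _ _ Ka Ca) _.
  rewrite /penalty opprD addrA !subrr add0r [dot 0 0]/dot mul0mx mxE !dot_linear.
  by rewrite /V; lra.
(* [V] is the penalty at [(a, a)]; this expansion cancels it and leaves [|d|^2 + k g <= 2 t v.d] for
   the minimiser. *)
have sqrB (d : 'rV[R]_n) :
    dot (d - t *: v) (d - t *: v) = dot d d - 2 * t * dot v d + V.
  by rewrite !dot_linear (dotC d v) /V; ring.
move: pV; rewrite {1}/penalty opprD addrA.
set d := p.1 - a; set g := dot (p.1 - p.2) _ => pV.
have g0 : 0 <= g by exact: dot_ge0.
have kg0 : g <= k * g by rewrite ler_peMl.
have kgV : k * g <= V by have := dot_ge0 (d - t *: v); lra.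
exists k, p; split=> //; last exact: le_trans kgV.
rewrite ltNge; apply/negP => far.
have mg : m <= g.
  apply: mS; split=> //; split; [split=> //=|exact: le_trans kgV].
  by rewrite -/d; have := sqrB d; lra.
have : k * m <= V by apply: le_trans kgV; rewrite ler_pM2l//; lra.
by rewrite /k mulrDl mul1r divfK ?gt_eqF// gerDr leNgt m0.
Qed.

(** The bound [|x - a| < t eta] does double duty: it keeps [x] near [a] and makes the error
    [|x - a| / t] in the normal less than [eta]. *)
Lemma fuzzy_intersection K C a v eps :
  closed K -> closed C -> regular_normal_cone (K `&` C) a v -> 0 < eps ->
  exists x y w,
    [/\ `|x - a| < eps, `|y - a| < eps, `|w - v| < eps
      & set_sum (regular_normal_cone K x) (regular_normal_cone C y) w].
Proof.
move=> cK cC nv eps0; have [KCa _] := nv.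
pose eta := eps / 4.
have eta0 : 0 < eta by rewrite divr_gt0.
have eta40 : 0 < eta / 4 by rewrite divr_gt0.
have [delta delta0 small] := regular_normal_eps _ _ _ _ nv eta40.
(* Each summand of [M] serves one estimate: [1] gives [t <= 1], [2 n |v|] keeps the relevant points
   within [delta] of [a], and [dot v v] gives [|x - y| <= eta]. *)
pose M := 1 + 2 * n%:R * `|v| + dot v v.
have M1 : 1 <= M by rewrite /M -addrA lerDl addr_ge0 ?dot_ge0 ?mulr_ge0.
have nv0 : 0 <= n%:R * `|v| by rewrite mulr_ge0.
pose t := Num.min 1 (Num.min (delta / 2) (eta ^+ 2)) / M.
have t0 : 0 < t.
  by rewrite divr_gt0 ?(lt_le_trans _ M1)// !lt_min ltr01 exprn_gt0// divr_gt0.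
have tM : t * M = Num.min 1 (Num.min (delta / 2) (eta ^+ 2)).
  by rewrite divfK// gt_eqF// (lt_le_trans _ M1).
have tM1 : t * M <= 1 by rewrite tM ge_min lexx.
have tMd : t * M <= delta / 2 by rewrite tM !ge_min lexx orbT.
have tMe : t * M <= eta ^+ 2 by rewrite tM !ge_min lexx !orbT.
have vv0 := dot_ge0 v.
have t1 : t <= 1 by nra.
have smallt x : (K `&` C) x -> `|x - a| <= 2 * t * n%:R * `|v| ->
    dot v (x - a) <= eta / 4 * `|x - a|.
  move=> KCx xa; apply: small => //; apply: le_lt_trans xa _.
  by rewrite /M in tMd; nra.
have [k [[x y] [KCp pmin xa xy]]] :=
  penalty_minimizer_near _ _ _ _ _ _ cK cC KCa t0 eta0 smallt.
have ti0 : 0 <= t^-1 by rewrite invr_ge0 ltW.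
have [nK nC] := penalty_normals _ _ _ _ _ _ KCp ti0 pmin.
rewrite /= in xa xy nK nC.
have tex : t * eta <= eta by rewrite ler_piMl// ltW.
have xye : `|x - y| <= eta.
  rewrite -(ler_pXn2r (n := 2)) ?nnegrE ?(ltW eta0)//.
  apply: le_trans (sqr_norm_le_dot _) (le_trans xy (le_trans _ tMe)).
  rewrite expr2 -mulrA ler_pM2l// (@le_trans _ _ (dot v v)) ?ler_piMl//.
  by rewrite /M; lra.
exists x, y, (v - t^-1 *: (x - a)); split.
- by rewrite /eta in xa tex; lra.
- have := ler_normB (x - a) (x - y).
  rewrite opprB addrAC -addrA addrCA addrA subrK.
  rewrite /eta in xa tex xye; lra.
- rewrite addrC addKr normrN normrZ gtr0_norm ?invr_gt0//.
  by rewrite ltr_pdivrMl// (lt_le_trans xa)// ler_pM2l// /eta; lra.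
(* The multiples of [x - y], possibly huge since [k] is uncontrolled, cancel in the sum. *)
- exists (t^-1 *: (a + t *: v - x - k *: (x - y))) => //.
  exists (t^-1 *: (k *: (x - y))) => //.
  rewrite -scalerDr subrK (_ : a + t *: v - x = t *: v - (x - a)).
    by rewrite scalerBr scalerA mulVf ?gt_eqF// scale1r.
  by rewrite opprB addrA (addrC a).
Qed.

End FuzzyIntersection.

(** The fuzzy rule is applied at each [a_ k] with tolerance [1/(k+1)], so base points and sums keep
    the limits of [a_] and [v_]; regular normals are in particular limiting ones. *)
Lemma limiting_normal_setI_sub_outer_limit {R : realType} {n : nat}
    (K C : set 'rV[R]_n) a :
  closed K -> closed C ->
  limiting_normal_cone (K `&` C) a `<=`
  outer_limit (fun x y => set_sum (limiting_normal_cone K x)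
                                  (limiting_normal_cone C y)) a a.
Proof.
move=> cK cC v [_ [a_ [v_ [aa _ vv nv]]]].
have H k : exists q : 'rV[R]_n * 'rV[R]_n * 'rV[R]_n,
    [/\ `|q.1.1 - a_ k| < harmonic k, `|q.1.2 - a_ k| < harmonic k,
        `|q.2 - v_ k| < harmonic k
      & set_sum (regular_normal_cone K q.1.1) (regular_normal_cone C q.1.2) q.2].
  have [x [y [w ?]]] := fuzzy_intersection _ _ _ _ _ cK cC (nv k) (harmonic_gt0 k).
  by exists (x, y, w).
have [q qP] := choice H.
have lim (f g : nat -> 'rV[R]_n) (l : 'rV[R]_n) :
    (forall k, `|f k - g k| < harmonic k) -> g @ \oo --> l -> f @ \oo --> l.
  move=> fg gl; have fg0 : f k - g k @[k --> \oo] --> (0 : 'rV[R]_n).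
    apply: norm_cvg0; apply: (squeeze_cvgr _ (cvg_cst 0) (@cvg_harmonic R)).
    by near=> k; rewrite normr_ge0 ltW//; exact: fg.
  rewrite -(add0r l); have -> : f = (fun k => f k - g k) + g.
    by apply/funext => k; rewrite /= subrK.
  exact: cvgD fg0 gl.
exists (fun k => (q k).1.1), (fun k => (q k).1.2), (fun k => (q k).2).
split; [apply: lim aa|apply: lim aa|apply: lim vv|] => k; have [? ? ? S] := qP k => //.
case: S => u nu [w nw uw]; exists u; first exact: regular_sub_limiting.
by exists w => //; exact: regular_sub_limiting.
Unshelve. all: by end_near. Qed.

Theorem theorem5p7 (R : realType) (n : nat) (K C : set 'rV[R]_n)
    (xbar : 'rV[R]_n)
    (K_closed : closed K) (C_closed : closed C)
    (xbarKC : (K `&` C) xbar)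
    (limsup_sub :
      outer_limit
        (fun x x' => set_sum (limiting_normal_cone K x)
                             (limiting_normal_cone C x')) xbar xbar
      `<=` set_sum (limiting_normal_cone K xbar)
                   (limiting_normal_cone C xbar)) :
  limiting_normal_cone (K `&` C) xbar
  `<=` set_sum (limiting_normal_cone K xbar) (limiting_normal_cone C xbar).
Proof.
by move=> v /(limiting_normal_setI_sub_outer_limit _ _ _ K_closed C_closed)/limsup_sub.
Qed.
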